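(* Let $S$ be a numerical semigroup. If there is some $k\in\mathbb{N}$ such that $S=\{l\in\mathbb{N}: l\ge k\}$, then the map $\sigma:\mathcal{P}_{\rm fin}(S)\to\mathcal{P}_{\rm fin}(S)$, $X\mapsto \max X-X+\min X=\{\max X-x+\min X: x\in X\}$, is an involutive automorphism of $\mathcal{P}_{\rm fin}(S)$, and it is the only non-trivial (that is, non-identity) automorphism of $\mathcal{P}_{\rm fin}(S)$. Otherwise (if $S$ is not of this form), the only automorphism of $\mathcal{P}_{\rm fin}(S)$ is the identity.
   Context: $\mathbb{N}$ denotes the additive monoid of non-negative integers. A numerical semigroup is a subsemigroup $S$ of $(\mathbb{N},+)$ such that $\mathbb{N}\setminus S$ is finite ($S$ need not contain $0$, and $S=\mathbb{N}$ is allowed). $\mathcal{P}_{\rm fin}(S)$ is the semigroup of all non-empty finite subsets of $S$ under setwise addition $X+Y=\{x+y: x\in X,\ y\in Y\}$. An automorphism is a bijective map preserving this operation. For a non-empty finite set $X\subseteq\mathbb{N}$, $\min X$ and $\max X$ are its minimum and maximum. *)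

(* Defs.v *)
From HB Require Import structures.
From mathcomp Require Import all_boot finmap.

Set Implicit Arguments.
Unset Strict Implicit.
Unset Printing Implicit Defensive.

Local Open Scope fset_scope.
Local Open Scope nat_scope.

(* The carrier may be a boolean predicate without loss of generality, as a
   cofinite subset of nat is decidable.  It need not contain 0, and it is
   nonempty because its complement is finite. *)
Record numSemigroup := NumSemigroup {
  numSemigroup_pred :> {pred nat};
  numSemigroupD : {in numSemigroup_pred &, forall x y, x + y \in numSemigroup_pred};
  numSemigroup_cofinite :
    exists F : {fset nat}, forall x, (x \in F) = (x \notin numSemigroup_pred)
}.

Record pfin (S : numSemigroup) := Pfin {
  fset_of_pfin :> {fset nat};
  pfinP : (fset_of_pfin != fset0) && all [in S] fset_of_pfin
}.

HB.instance Definition _ (S : numSemigroup) := [isSub for @fset_of_pfin S].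
HB.instance Definition _ (S : numSemigroup) := [Choice of pfin S by <:].

Definition sumset (X Y : {fset nat}) : {fset nat} :=
  [fset x + y | x in X, y in Y].

Lemma sumsetP (X Y : {fset nat}) z :
  reflect (exists x y, [/\ x \in X, y \in Y & z = x + y]) (z \in sumset X Y).
Proof.
apply: (iffP idP) => [/imfset2P[x /= Xx [y /= Yy ->]]|[x [y [Xx Yy ->]]]].
  by exists x, y.
by apply/imfset2P; exists x => //; exists y.
Qed.

Lemma sumsetC : commutative sumset.
Proof.
by move=> X Y; apply/fsetP => z; apply/sumsetP/sumsetP;
  move=> [x [y [xin yin ->]]]; exists y, x; rewrite addnC.
Qed.

Lemma sumsetA : associative sumset.
Proof.
move=> X Y Z; apply/fsetP => t; apply/sumsetP/sumsetP.
  move=> [x [_ [Xx /sumsetP[y [z [Yy Zz ->]]] ->]]].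
  by exists (x + y), z; rewrite addnA; split=> //; apply/sumsetP; exists x, y.
move=> [_ [z [/sumsetP[x [y [Xx Yy ->]]] Zz ->]]].
by exists x, (y + z); rewrite addnA; split=> //; apply/sumsetP; exists y, z.
Qed.

Section PfinSemigroup.
Variable S : numSemigroup.
Implicit Types X Y Z : pfin S.

Fact pfin_add_subproof X Y :
  (sumset X Y != fset0) && all [in S] (sumset X Y).
Proof.
case: X Y => [X /= /andP[/fset0Pn[x Xx] /allP XS]].
case=> [Y /= /andP[/fset0Pn[y Yy] /allP YS]].
apply/andP; split; first by apply/fset0Pn; exists (x + y); apply/sumsetP; exists x, y.
apply/allP => _ /sumsetP[a [b [Xa Yb ->]]].
by apply: numSemigroupD; [apply: XS | apply: YS].
Qed.

Definition pfin_add X Y : pfin S := Pfin (pfin_add_subproof X Y).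

Fact pfin_addC : commutative pfin_add.
Proof. by move=> X Y; apply: val_inj; apply: sumsetC. Qed.

Fact pfin_addA : associative pfin_add.
Proof. by move=> X Y Z; apply: val_inj; apply: sumsetA. Qed.

HB.instance Definition _ :=
  Algebra.isAddSemigroup.Build (pfin S) pfin_addC pfin_addA.

End PfinSemigroup.

Definition automorphism (V : addSemigroupType) (f : V -> V) : Prop :=
  bijective f /\ {morph f : x y / (x + y)%R}.

Definition fmax (X : {fset nat}) : nat := \max_(x <- X) x.

(* [minn] has no neutral element on nat; starting from [fmax X] makes this the
   minimum whenever [X] is nonempty. *)
Definition fmin (X : {fset nat}) : nat := \big[minn/fmax X]_(x <- X) x.

Lemma fmax_ge (X : {fset nat}) x : x \in X -> x <= fmax X.
Proof. by move=> Xx; apply: leq_bigmax_seq. Qed.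

Lemma fmax_in (X : {fset nat}) : X != fset0 -> fmax X \in X.
Proof.
case/fset0Pn=> x0 Xx0.
suff: fmax X \in X \/ fmax X = 0.
  by case=> // m0; have := fmax_ge Xx0; rewrite m0 leqn0 -m0 => /eqP <-.
rewrite /fmax big_seq; elim/big_rec: _ => [|x m Xx IH]; first by right.
by left; case: (leqP x m) => // le; case: IH => // m0; move: le; rewrite m0 leqn0 => /eqP<-.
Qed.

Lemma fmin_le (X : {fset nat}) x : x \in X -> fmin X <= x.
Proof.
rewrite /fmin => Xx; have {Xx}: x \in enum_fset X by [].
move: (fmax X) => d; elim: (enum_fset X) => // y s IH.
rewrite inE big_cons => /predU1P[->|/IH]; first exact: geq_minl.
exact/leq_trans/geq_minr.
Qed.

Lemma fmin_in (X : {fset nat}) : X != fset0 -> fmin X \in X.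
Proof.
move=> /fmax_in XM; rewrite /fmin big_seq; elim/big_rec: _ => // x m Xx Xm.
by rewrite /minn; case: ifP.
Qed.

(* Main.v *)
(**
Singletons are the cancellative elements of [pfin S], so an automorphism [f]
restricts to an additive bijection of [S], which can only be the identity.
Hence [f] commutes with translations by elements of [S].  Adding a long
interval to [X] leaves only [min X] and [max X] visible, so [min (f X)]
depends on these two numbers alone; since no element of [f X] lies below the
least element of [S], this forces [min (f X) = min X].  Translating, [f]
becomes an automorphism [G] of the finite sets of least element 0, and the
same absorption by intervals shows that [G] preserves maxima and fixes [[0, n]].

The key sets are the spurs [{0} u [b, c]] with [c >= 2b - 1].  Both ends of the
initial gap are detected by divisibility by intervals, so the image of a spur
has a gap of length [b] at its bottom or at its top; because a spur plus a
reflected spur is an interval, the same alternative holds for all spurs.  After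
composing with the reflection we may assume that [G] keeps these gaps in place.
Adding a spur with [b = p + 1] to [X] forgets everything about [X] beyond [p],
so the trace of [G X] on [[0, p]] depends only on that of [X], and dually from
the right.  If [p] is in [X], the set [Y = (X n [0, p]) u [p, max X]] has the
left trace of [X] and the right trace of an interval, so [p] is in [G Y] and
thus in [G X].  So [X] is contained in [G X] for all [X], whence [G = id].
*)

Require Import Defs.
From mathcomp Require Import all_boot finmap.
From mathcomp Require Import zify.

Set Implicit Arguments.
Unset Strict Implicit.
Unset Printing Implicit Defensive.

Local Open Scope fset_scope.
Local Open Scope nat_scope.

(** * Extrema and translates of sumsets *)

Lemma mem_sumset (X Y : {fset nat}) x y z :
  x \in X -> y \in Y -> z = x + y -> z \in sumset X Y.
Proof. by move=> Xx Yy ->; apply/sumsetP; exists x, y. Qed.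

Lemma fmaxE (X : {fset nat}) m :
  m \in X -> (forall x, x \in X -> x <= m) -> fmax X = m.
Proof.
move=> Xm le_m; apply/eqP; rewrite eqn_leq fmax_ge // andbT le_m //.
by apply: fmax_in; apply/fset0Pn; exists m.
Qed.

Lemma fminE (X : {fset nat}) m :
  m \in X -> (forall x, x \in X -> m <= x) -> fmin X = m.
Proof.
move=> Xm ge_m; apply/eqP; rewrite eqn_leq fmin_le //= ge_m //.
by apply: fmin_in; apply/fset0Pn; exists m.
Qed.

Lemma fmax_sumset X Y :
  X != fset0 -> Y != fset0 -> fmax (sumset X Y) = fmax X + fmax Y.
Proof.
move=> X0 Y0; apply: fmaxE; first by apply: mem_sumset (fmax_in X0) (fmax_in Y0) _.
by move=> _ /sumsetP[x [y [/fmax_ge Xx /fmax_ge Yy ->]]]; apply: leq_add.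
Qed.

Lemma fmin_sumset X Y :
  X != fset0 -> Y != fset0 -> fmin (sumset X Y) = fmin X + fmin Y.
Proof.
move=> X0 Y0; apply: fminE; first by apply: mem_sumset (fmin_in X0) (fmin_in Y0) _.
by move=> _ /sumsetP[x [y [/fmin_le Xx /fmin_le Yy ->]]]; apply: leq_add.
Qed.

Lemma mem_neq0 (X : {fset nat}) x : x \in X -> X != fset0.
Proof. by move=> Xx; apply/fset0Pn; exists x. Qed.

Lemma fmax1 a : fmax [fset a] = a.
Proof. by apply: fmaxE => [|x]; rewrite inE // => /eqP->. Qed.

Lemma fmin1 a : fmin [fset a] = a.
Proof. by apply: fminE => [|x]; rewrite inE // => /eqP->. Qed.

Lemma mem_sumset1 a X x : (x \in sumset [fset a] X) = (a <= x) && (x - a \in X).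
Proof.
apply/sumsetP/andP => [[_ [y [/fset1P-> Xy ->]]]|[le_ax Xx]].
  by rewrite leq_addr addKn.
by exists a, (x - a); rewrite inE eqxx subnKC.
Qed.

Lemma sumset1_inj a : injective (sumset [fset a]).
Proof.
move=> X Y eqXY; apply/fsetP => x.
by have /fsetP/(_ (a + x)) := eqXY; rewrite !mem_sumset1 leq_addr addKn.
Qed.

(** * Intervals, normalised homomorphisms and their action on maxima *)

Definition cut n (P : pred nat) : {fset nat} := [fset x in iota 0 n.+1 | P x].

Lemma in_cut n P x : (x \in cut n P) = (x <= n) && P x.
Proof. by rewrite in_fset inE mem_iota. Qed.

Definition segment n := cut n predT.

Lemma in_segment n x : (x \in segment n) = (x <= n).
Proof. by rewrite in_cut andbT. Qed.

Lemma fmax_cut n (P : pred nat) : P n -> fmax (cut n P) = n.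
Proof. by move=> Pn; apply: fmaxE => [|x]; rewrite in_cut ?leqnn // => /andP[]. Qed.

Lemma segmentD m n : sumset (segment m) (segment n) = segment (m + n).
Proof.
apply/fsetP => x; rewrite in_segment; apply/sumsetP/idP.
  by move=> [y [z [+ + ->]]]; rewrite !in_segment; apply: leq_add.
move=> le_x; exists (minn m x), (x - minn m x).
by rewrite !in_segment; split; lia.
Qed.

(* Sets are normalised by translation so that their minimum is 0. *)
Record normal_hom (G : {fset nat} -> {fset nat}) : Prop := NormalHom {
  normal_hom0 : forall X, 0 \in X -> 0 \in G X;
  normal_homD : forall X Y, 0 \in X -> 0 \in Y ->
    G (sumset X Y) = sumset (G X) (G Y) }.

Definition normal_cancel (G H : {fset nat} -> {fset nat}) :=
  forall X, 0 \in X -> H (G X) = X.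

Definition fmax_preserving (G : {fset nat} -> {fset nat}) :=
  forall X, 0 \in X -> fmax (G X) = fmax X.

(** The translates of [[0, n]] by 0 and by [fmax X] already leave no gap, so the inner elements of
    [X] are absorbed. *)
Lemma sumset_segment X n : 0 \in X -> fmax X <= n ->
  sumset X (segment n) = segment (fmax X + n).
Proof.
move=> X0 le_Xn; have Xm := fmax_in (mem_neq0 X0).
apply/fsetP => x; rewrite in_segment; apply/sumsetP/idP.
  by move=> [y [z [/fmax_ge Xy + ->]]]; rewrite in_segment; apply: leq_add.
have [le_xn _|lt_nx le_x] := leqP x n; first by exists 0, x; rewrite in_segment.
by exists (fmax X), (x - fmax X); rewrite in_segment; split=> //; lia.
Qed.

Lemma segment0 n : 0 \in segment n. Proof. by rewrite in_segment. Qed.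

Lemma fmax_segment n : fmax (segment n) = n. Proof. exact: fmax_cut. Qed.

Lemma normal_hom_segment0 G : normal_hom G -> fmax (G (segment 0)) = 0.
Proof.
move=> homG; have G0 := normal_hom0 homG (segment0 0).
have := normal_homD homG (segment0 0) (segment0 0).
move/(congr1 fmax); rewrite segmentD fmax_sumset ?(mem_neq0 G0) //.
by rewrite addn0; lia.
Qed.

(** On intervals [fmax (G _)] is additive, hence linear. With [m = fmax X], the identity [X + [0, m]
    = [0, 2m]] carries this over to [X]. *)
Lemma fmax_normal_hom G X : normal_hom G -> 0 \in X ->
  fmax (G X) = fmax X * fmax (G (segment 1)).
Proof.
move=> homG X0; have GN0 Y : 0 \in Y -> G Y != fset0.
  by move/(normal_hom0 homG)/mem_neq0.
have fmaxI n : fmax (G (segment n)) = n * fmax (G (segment 1)).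
  elim: n => [|n IHn]; first by rewrite normal_hom_segment0.
  rewrite -(addn1 n) -segmentD (normal_homD homG) ?segment0 //.
  by rewrite fmax_sumset ?GN0 ?segment0 // IHn mulnDl mul1n.
have := fmaxI (fmax X + fmax X); rewrite -sumset_segment //.
rewrite (normal_homD homG) ?segment0 // fmax_sumset ?GN0 ?segment0 // fmaxI.
by rewrite mulnDl => /addIn.
Qed.

(** The scaling factors of [G] and [H] multiply to 1, as one sees by applying [H] to [G [0, 1]]. *)
Lemma normal_aut_fmax G H : normal_hom G -> normal_hom H -> normal_cancel G H ->
  fmax_preserving G.
Proof.
move=> homG homH GK X X0; have GI0 := normal_hom0 homG (segment0 1).
have := fmax_normal_hom homH GI0; rewrite GK ?segment0 // fmax_segment => /esym/eqP.
by rewrite muln_eq1 (fmax_normal_hom homG X0) => /andP[/eqP-> _]; rewrite muln1.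
Qed.

(** * Reflection of normalised sets *)

Definition reflect_set (X : {fset nat}) : {fset nat} := [fset fmax X - x | x in X].

Lemma in_reflect X y :
  (y \in reflect_set X) = (y <= fmax X) && (fmax X - y \in X).
Proof.
apply/imfsetP/andP => [[x /= Xx ->]|[le_y Xy]].
  by rewrite leq_subr subKn ?fmax_ge.
by exists (fmax X - y); rewrite ?subKn.
Qed.

Lemma reflect0 X : 0 \in X -> 0 \in reflect_set X.
Proof. by move=> X0; rewrite in_reflect subn0 /= fmax_in ?(mem_neq0 X0). Qed.

Lemma fmax_reflect X : 0 \in X -> fmax (reflect_set X) = fmax X.
Proof.
move=> X0; apply: fmaxE => [|x]; first by rewrite in_reflect leqnn subnn.
by rewrite in_reflect => /andP[].
Qed.

Lemma reflectK X : 0 \in X -> reflect_set (reflect_set X) = X.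
Proof.
move=> X0; apply/fsetP => x; rewrite !in_reflect fmax_reflect //.
have [le_x|lt_x] := leqP x (fmax X); first by rewrite leq_subr subKn.
by apply/esym/negP => /fmax_ge; rewrite leqNgt lt_x.
Qed.

Lemma reflectD X Y : 0 \in X -> 0 \in Y ->
  reflect_set (sumset X Y) = sumset (reflect_set X) (reflect_set Y).
Proof.
move=> X0 Y0; apply/fsetP => z; rewrite in_reflect.
rewrite fmax_sumset ?(mem_neq0 X0) ?(mem_neq0 Y0) //.
apply/andP/sumsetP.
  move=> [le_z /sumsetP[x [y [Xx Yy def_z]]]]; exists (fmax X - x), (fmax Y - y).
  rewrite !in_reflect; have lex := fmax_ge Xx; have ley := fmax_ge Yy.
  by rewrite !subKn // Xx Yy; split; lia.
move=> [x [y []]]; rewrite !in_reflect => /andP[lex Xx] /andP[ley Yy] ->.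
by rewrite leq_add //; split=> //; apply: mem_sumset Xx Yy _; lia.
Qed.

Lemma reflect_segment n : reflect_set (segment n) = segment n.
Proof.
by apply/fsetP => x; rewrite in_reflect !in_segment fmax_segment leq_subr andbT.
Qed.

Lemma normal_hom_reflectl G :
  normal_hom G -> normal_hom (fun X => reflect_set (G X)).
Proof.
move=> [G0 GD]; split=> [X /G0/reflect0 //|X Y X0 Y0].
by rewrite GD // reflectD ?G0.
Qed.

Lemma normal_hom_reflectr G :
  normal_hom G -> normal_hom (fun X => G (reflect_set X)).
Proof.
move=> [G0 GD]; split=> [X /reflect0/G0 //|X Y X0 Y0].
by rewrite reflectD // GD ?reflect0.
Qed.

Lemma fmax_preserving_reflectl G :
  normal_hom G -> fmax_preserving G -> fmax_preserving (fun X => reflect_set (G X)).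
Proof. by move=> [G0 _] Gm X X0; rewrite fmax_reflect ?G0 ?Gm. Qed.

Lemma fmax_preserving_reflectr G :
  fmax_preserving G -> fmax_preserving (fun X => G (reflect_set X)).
Proof. by move=> Gm X X0; rewrite Gm ?reflect0 ?fmax_reflect. Qed.

(** The only set with least element 0 and maximum 1 is [[0, 1]], and sums of copies of it give the
    longer intervals. *)
Lemma normal_hom_segment G n :
  normal_hom G -> fmax_preserving G -> G (segment n) = segment n.
Proof.
move=> homG Gm.
have I1 : G (segment 1) = segment 1.
  have G0 := normal_hom0 homG (segment0 1).
  have := Gm _ (segment0 1); rewrite fmax_segment => max1.
  have := fmax_in (mem_neq0 G0); rewrite max1 => G1.
  apply/fsetP => x; rewrite in_segment; apply/idP/idP => [/fmax_ge|].
    by rewrite max1.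
  by case: x => [|[|]].
elim: n => [|n IHn]; last first.
  by rewrite -addn1 -segmentD (normal_homD homG) ?segment0 // IHn I1.
apply/fsetP => x; rewrite in_segment leqn0; apply/idP/eqP => [/fmax_ge|->].
  by rewrite Gm ?segment0 // fmax_segment leqn0 => /eqP.
exact: normal_hom0 homG _ (segment0 0).
Qed.

(** * Spurs and the position of their gap *)

Definition spur b c := cut c (fun x => (x == 0) || (b <= x)).

Lemma in_spur b c x : (x \in spur b c) = (x <= c) && ((x == 0) || (b <= x)).
Proof. exact: in_cut. Qed.

Lemma spur0 b c : 0 \in spur b c. Proof. by rewrite in_spur. Qed.

Lemma fmax_spur b c : b <= c -> fmax (spur b c) = c.
Proof. by move=> le_bc; rewrite fmax_cut ?le_bc ?orbT. Qed.

Definition avoid b (X : {fset nat}) := forall x, 0 < x < b -> x \notin X.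

Lemma avoidD b X Y : avoid b X -> avoid b Y -> avoid b (sumset X Y).
Proof.
move=> aX aY z z_b; apply/negP => /sumsetP[x [y [Xx Yy def_z]]].
have [x0|x0] := posnP x; first by move: Yy; apply/negP/aY; lia.
by move: Xx; apply/negP/aX; lia.
Qed.

Lemma avoid_sumsetl b X Y : 0 \in Y -> avoid b (sumset X Y) -> avoid b X.
Proof.
move=> Y0 aXY x x_b; apply: contra (aXY x x_b) => Xx.
by apply: mem_sumset Xx Y0 _; rewrite addn0.
Qed.

Lemma sumset_spur X b c : 0 \in X -> fmax X + b <= c ->
  sumset X (spur b c) = cut (fmax X + c) (fun x => (x \in X) || (b <= x)).
Proof.
move=> X0 le_c; have Xm := fmax_in (mem_neq0 X0).
apply/fsetP => z; rewrite in_cut; apply/sumsetP/idP.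
  move=> [x [y [Xx]]]; rewrite in_spur => /andP[le_y y_b] ->.
  rewrite leq_add ?fmax_ge //=; case/orP: y_b => [/eqP->|le_b].
    by rewrite addn0 Xx.
  by rewrite orbC (leq_trans le_b) ?leq_addl.
case/andP=> le_z /orP[Xz|le_bz].
  by exists z, 0; rewrite in_spur addn0.
have [le_zc|lt_cz] := leqP z c; first by exists 0, z; rewrite in_spur le_zc le_bz orbT.
by exists (fmax X), (z - fmax X); split=> //; [rewrite in_spur|]; lia.
Qed.

(** The bounds on [c] and [d] ensure that [[b, c]] and [[b, d]] reach up to [[2b, c + d]] without a
    gap. *)
Lemma spurD b c d : 0 < b -> b.*2 <= c.+1 -> b.*2 <= d.+1 ->
  sumset (spur b c) (spur b d) = spur b (c + d).
Proof.
move=> b0 le_c le_d; apply/fsetP => z; rewrite in_spur; apply/sumsetP/idP.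
  by move=> [x [y []]]; rewrite !in_spur => Hx Hy ->; lia.
move=> Hz; have [z0|z0] := posnP z; first by exists 0, 0; rewrite !in_spur; split; lia.
have [le_zc|lt_cz] := leqP z c; first by exists z, 0; rewrite !in_spur; split; lia.
have [le_cbz|lt] := leqP (c + b) z.
  by exists c, (z - c); rewrite !in_spur; split; lia.
by exists (z - b), b; rewrite !in_spur; split; lia.
Qed.

Definition direct b (G : {fset nat} -> {fset nat}) :=
  forall c, b.*2 <= c.+1 -> avoid b (G (spur b c)).

(** Avoidance passes to sums, and from a sum to its summands. Multiples of the shortest spur are
    again spurs, and every admissible spur is a summand of one of them. *)
Lemma avoid_direct b G : 1 < b -> normal_hom G ->
  avoid b (G (spur b b.*2.-1)) -> direct b G.
Proof.
move=> b1 homG avG c le_c.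
have avGn n : avoid b (G (spur b (n.+1 * b.*2.-1))).
  elim: n => [|n IHn]; first by rewrite mul1n.
  rewrite mulSn -spurD; [|lia|lia|]; last by rewrite mulSn -addSn (leq_trans _ (leq_addr _ _)) //; lia.
  by rewrite (normal_homD homG) ?spur0 //; apply: avoidD.
(* The complement [c' = c (2b - 2)] makes [c + c'] the multiple [c (2b - 1)]. *)
have [c' le_c' def_c] : exists2 c', b.*2 <= c'.+1 & c + c' = c.-1.+1 * b.*2.-1.
  exists (c * b.*2.-2); first by rewrite (leq_trans le_c) // ltnS leq_pmulr //; lia.
  by rewrite -mulnS !prednK //; lia.
have := avGn c.-1; rewrite -def_c -spurD ?(ltnW b1) // (normal_homD homG) ?spur0 //.
by apply: avoid_sumsetl; apply: (normal_hom0 homG); apply: spur0.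
Qed.

(** Adding [[0, b-2]] shrinks the gap [[1, b-1]] to its last point, and adding [[0, b-1]] closes it
    ([spur_segment1]). Together these two sums express the length of the gap by means of intervals,
    which normalised automorphisms fix. *)
Lemma spur_segment b : 1 < b ->
  sumset (spur b b.*2.-1) (segment b.-2) = cut (3 * b - 3) (fun x => x != b.-1).
Proof.
move=> b1; apply/fsetP => z; rewrite in_cut; apply/sumsetP/idP.
  by move=> [x [y []]]; rewrite in_spur in_segment => Hx Hy ->; lia.
move=> Hz; have [le_z|lt_z] := leqP z b.-2.
  by exists 0, z; rewrite in_spur in_segment; split; lia.
exists (minn z b.*2.-1), (z - minn z b.*2.-1).
by rewrite in_spur in_segment; split; lia.
Qed.

Lemma spur_segment1 b : 0 < b ->
  sumset (spur b b.*2.-1) (segment b.-1) = segment (3 * b - 2).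
Proof.
move=> b1; apply/fsetP => z; rewrite in_segment; apply/sumsetP/idP.
  by move=> [x [y []]]; rewrite in_spur in_segment => Hx Hy ->; lia.
move=> Hz; have [le_z|lt_z] := leqP z b.-1.
  by exists 0, z; rewrite in_spur in_segment; split; lia.
exists (minn z b.*2.-1), (z - minn z b.*2.-1).
by rewrite in_spur in_segment; split; lia.
Qed.

(* Any hole of [G (spur b (2b-1)) + [0, b-2]] at an intermediate place would make
   that sum divisible by [0, b-1], which [spur b (2b-1) + [0, b-2]] is not. *)
Lemma avoid_spur G H b : 1 < b -> normal_hom G -> normal_hom H ->
  fmax_preserving G -> fmax_preserving H -> normal_cancel G H ->
  avoid b (G (spur b b.*2.-1)) \/ avoid b (reflect_set (G (spur b b.*2.-1))).
Proof.
move=> b1 homG homH Gm Hm GK; set Z := G _.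
have Z0 : 0 \in Z by apply: (normal_hom0 homG); apply: spur0.
have maxZ : fmax Z = b.*2.-1 by rewrite Gm ?spur0 // fmax_spur //; lia.
have Zmax : b.*2.-1 \in Z by rewrite -maxZ fmax_in // (mem_neq0 Z0).
have le_Z x : x \in Z -> x <= b.*2.-1 by move/fmax_ge; rewrite maxZ.
have GP : G (cut (3 * b - 3) (fun x => x != b.-1)) = sumset Z (segment b.-2).
  by rewrite -spur_segment // (normal_homD homG) ?spur0 ?segment0 // normal_hom_segment.
have P0 : 0 \in cut (3 * b - 3) (fun x => x != b.-1) by rewrite in_cut; lia.
have ZI : sumset Z (segment b.-1) = segment (3 * b - 2).
  rewrite -[in LHS](normal_hom_segment b.-1 homG) //.
  rewrite -(normal_homD homG) ?spur0 ?segment0 // spur_segment1; last by lia.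
  by rewrite normal_hom_segment.
have HZI : H (sumset Z (segment b.-2)) = cut (3 * b - 3) (fun x => x != b.-1).
  by rewrite -GP GK.
(* Without a hole the sum would be an interval, which [H] fixes, whereas its image under [H] misses
   [b-1]. *)
have [p le_p ZIp] : exists2 p, p <= 3 * b - 3 & p \notin sumset Z (segment b.-2).
  have [full|] := boolP (all [in sumset Z (segment b.-2)] (iota 0 (3 * b - 2))).
    have eqI : sumset Z (segment b.-2) = segment (3 * b - 3).
      apply/fsetP => x; rewrite in_segment; apply/idP/idP.
        by move/sumsetP=> [y [z [/le_Z + + ->]]]; rewrite in_segment; lia.
      by move=> le_x; apply: (allP full); rewrite mem_iota; lia.
    move: HZI; rewrite eqI normal_hom_segment // => /fsetP/(_ b.-1).
    by rewrite in_segment in_cut eqxx andbF; lia.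
  by case/allPn=> p; rewrite mem_iota => le_p ZIp; exists p => //; lia.
(* No element of [Z] lies in [[p-(b-2), p]]. Since 0 and [2b-1] are in [Z], this gives
   [b-1 <= p <= 2b-2]. The two extreme values of [p] are the two alternatives of the lemma. *)
have hole x : x \in Z -> p < x \/ x + b.-2 < p.
  move=> Zx; case: (ltnP p x) => [|le_xp]; [by left | right].
  rewrite ltnNge; apply: contra ZIp => lt_p.
  by apply: (mem_sumset Zx (y := p - x)); rewrite ?in_segment; lia.
have := hole _ Z0; have := hole _ Zmax => p_lt p_gt.
have [p_b|p_b] := eqVneq p b.-1.
  by left=> x x_b; apply/negP => /hole; lia.
have [p_b2|p_b2] := eqVneq p b.*2.-2.
  by right=> x x_b; rewrite in_reflect maxZ; apply/negP => /andP[lex /hole]; lia.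
(* For [b <= p <= 2b-3], the set [V = [0, p-b] u [p+1, 2b-2]] is chosen so that [V + [0, b-1]] is
   [[0, 3b-3]] without [p]. *)
pose V := cut b.*2.-2 (fun x => (x <= p - b) || (p < x)).
have V0 : 0 \in V by rewrite in_cut.
have ZI_near q : q <= 3 * b - 2 -> exists2 z, z \in Z & z <= q <= z + b.-1.
  move=> le_q; have : q \in sumset Z (segment b.-1) by rewrite ZI in_segment.
  by case/sumsetP=> [z [y [Zz + ->]]]; rewrite in_segment; exists z => //; lia.
(* Adding [[0, b-1]] to [Z] reaches both [p] and [p+1], but adding [[0, b-2]] does not reach [p].
   This forces [p-b+1] and [p+1] into [Z]. *)
have Zpb : p - b.-1 \in Z.
  have [z Zz le_z] := ZI_near p (ltac:(lia)); have := hole _ Zz => hz.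
  by have -> : p - b.-1 = z by lia.
have Zp1 : p.+1 \in Z.
  have [z Zz le_z] := ZI_near p.+1 (ltac:(lia)); have := hole _ Zz => hz.
  by have -> : p.+1 = z by lia.
have def_ZI : sumset Z (segment b.-2) = sumset V (segment b.-1).
  transitivity (cut (3 * b - 3) (fun x => x != p)); apply/fsetP => x; rewrite in_cut.
    apply/idP/idP => [/[dup] ZIx|le_x].
      have -> : x != p by apply: contraNneq ZIp => <-.
      by case/sumsetP=> [y [z [/le_Z + + ->]]]; rewrite in_segment; lia.
    have [z Zz le_z] : exists2 z, z \in Z & z <= x <= z + b.-2.
      have [?|?] := leqP x b.-2; first by exists 0 => //; lia.
      have [?|?] := ltnP x p; first by exists (p - b.-1) => //; lia.
      have [?|?] := ltnP x b.*2.-1; first by exists p.+1 => //; lia.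
      by exists b.*2.-1 => //; lia.
    by apply: (mem_sumset Zz (y := x - z)); rewrite ?in_segment; lia.
  apply/idP/sumsetP => [le_x|[y [z []]]]; last first.
    by rewrite in_cut in_segment => Hy Hz ->; lia.
  have [lt_xp|le_px] := ltnP x p.
    exists (minn x (p - b)), (x - minn x (p - b)).
    by rewrite in_cut in_segment; split; lia.
  exists (minn x b.*2.-2), (x - minn x b.*2.-2).
  by rewrite in_cut in_segment; split; lia.
(* The contradiction: [H V + [0, b-1]] contains [b-1] because 0 is in [H V], yet it equals a set
   without [b-1]. *)
have : b.-1 \in sumset (H V) (segment b.-1).
  by apply: (mem_sumset (normal_hom0 homH V0) (y := b.-1)); rewrite ?in_segment.
rewrite -[segment b.-1](normal_hom_segment b.-1 homH) // -(normal_homD homH) ?segment0 //.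
by rewrite -def_ZI HZI in_cut eqxx andbF.
Qed.

Lemma direct_dichotomy G H b : 1 < b -> normal_hom G -> normal_hom H ->
  fmax_preserving G -> fmax_preserving H -> normal_cancel G H ->
  direct b G \/ direct b (fun X => reflect_set (G X)).
Proof.
move=> b1 homG homH Gm Hm GK.
case: (avoid_spur b1 homG homH Gm Hm GK) => avG; [left|right].
  exact: avoid_direct.
by apply: avoid_direct => //; apply: normal_hom_reflectl.
Qed.

(* [spur b c + reflect_set (spur b' c')] is an interval. *)
Lemma direct_incompatible F b b' : 1 < b -> 1 < b' ->
  normal_hom F -> fmax_preserving F ->
  direct b F -> direct b' (fun X => F (reflect_set X)) -> False.
Proof.
move=> b1 b'1 homF Fm dF dF'; pose c := b.*2 + b'.*2.
have [lec lec'] : b <= c /\ b' <= c by rewrite /c; lia.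
(* The contradiction comes from the point 1: both images miss it, hence so does their sum, which is
   an interval of positive length. *)
have avF : avoid 2 (F (spur b c)).
  by move=> x x2; apply: (dF c); rewrite /c; lia.
have avF' : avoid 2 (F (reflect_set (spur b' c))).
  by move=> x x2; apply: (dF' c); rewrite /c; lia.
have [s0 r0] := (spur0 b c, reflect0 (spur0 b' c)).
have := avoidD avF avF'; rewrite -(normal_homD homF) //.
have -> : sumset (spur b c) (reflect_set (spur b' c)) = segment (c + c).
  apply/fsetP => z; rewrite in_segment; apply/sumsetP/idP.
    by move=> [x [y []]]; rewrite in_reflect !in_spur fmax_spur // => Hx Hy ->; lia.
  move=> le_z; have [le_zb|lt_zb] := leqP z b.
    by exists 0, z; rewrite in_reflect !in_spur fmax_spur // /c; split; lia.
  have [lt_zc|le_cz] := ltnP z c.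
    by exists z, 0; rewrite in_reflect !in_spur fmax_spur // /c; split; lia.
  have [le_zb'|lt_zb'] := leqP z (c + (c - b')).
    by exists c, (z - c); rewrite in_reflect !in_spur fmax_spur // /c; split; lia.
  by exists (z - c), c; rewrite in_reflect !in_spur fmax_spur //; split; lia.
rewrite normal_hom_segment // => /(_ 1 isT); rewrite in_segment.
by rewrite /c; lia.
Qed.

(** * Traces and rigidity of direct homomorphisms *)

Lemma direct_trace F X Y p : normal_hom F -> (forall b, 1 < b -> direct b F) ->
  0 \in X -> 0 \in Y -> (forall x, x <= p -> (x \in X) = (x \in Y)) ->
  (p \in F X) = (p \in F Y).
Proof.
move=> homF dF X0 Y0 eqXY.
have [->|p0] := posnP p; first by rewrite !(normal_hom0 homF).
pose b := p.+1.
(* The image of the spur has no element in [[1, p]], so a sum equal to [p] can only use its element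
   0. *)
have traceF Z c : 0 \in Z -> b.*2 + fmax Z <= c ->
    (p \in F Z) = (p \in F (sumset Z (spur b c))).
  move=> Z0 le_c; rewrite (normal_homD homF) ?spur0 //.
  apply/idP/sumsetP => [FZp|[x [y [Fx Fy def_p]]]].
    by exists p, 0; rewrite addn0 (normal_hom0 homF) ?spur0.
  have [y0|y0] := posnP y; first by rewrite def_p y0 addn0.
  by case/negP: (dF b (ltac:(rewrite /b; lia)) c (ltac:(lia)) y (ltac:(rewrite /b; lia))).
(* The two constants make the sums with [X] and [Y] have the same maximum. *)
pose cX := b.*2 + fmax X + (fmax Y).*2; pose cY := b.*2 + (fmax X).*2 + fmax Y.
rewrite (traceF X cX) ?(traceF Y cY) //; [|rewrite /cY; lia|rewrite /cX; lia].
congr (_ \in F _); rewrite !sumset_spur //; [|rewrite /cY; lia|rewrite /cX; lia].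
apply/fsetP => x; rewrite !in_cut.
have -> : fmax X + cX = fmax Y + cY by rewrite /cX /cY; lia.
by have [lt_bx|/eqXY->] := ltnP p x; rewrite ?orbT.
Qed.

Lemma direct_subset G X : normal_hom G -> fmax_preserving G ->
  (forall b, 1 < b -> direct b G) ->
  (forall b, 1 < b -> direct b (fun Y => reflect_set (G (reflect_set Y)))) ->
  0 \in X -> {subset X <= G X}.
Proof.
move=> homG Gm dG drG X0 p Xp; have le_p := fmax_ge Xp; set m := fmax X in le_p.
pose Y := cut m (fun x => (x \in X) || (p <= x)).
have Y0 : 0 \in Y by rewrite in_cut X0.
have maxY : fmax Y = m by rewrite fmax_cut ?le_p ?orbT.
have -> : (p \in G X) = (p \in G Y).
  apply: direct_trace => // x le_xp; rewrite in_cut (leq_trans le_xp) //=.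
  by have [->|ne_xp] := eqVneq x p; rewrite ?Xp // [p <= x]leqNgt ltn_neqAle ne_xp le_xp orbF.
have homrG := normal_hom_reflectl (normal_hom_reflectr homG).
(* The right trace of [Y] from [p] on is the left trace of its reflection up to [m - p]. *)
have := @direct_trace _ (reflect_set Y) (segment m) (m - p) homrG drG
          (reflect0 Y0) (segment0 m).
rewrite reflectK // reflect_segment normal_hom_segment // reflect_segment.
rewrite in_segment leq_subr in_reflect Gm // maxY leq_subr subKn // andTb => -> //.
move=> x le_x; rewrite in_segment in_reflect maxY in_cut; lia.
Qed.

(** If [G X] were strictly larger than [X], then, having the same maximum, it would be fixed by [G]
    by induction on the number of missing points. Injectivity of [G] then gives [G X = X]. *)
Lemma normal_aut_id G H X : normal_hom G -> fmax_preserving G -> normal_cancel G H ->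
  (forall Y, 0 \in Y -> {subset Y <= G Y}) -> 0 \in X -> G X = X.
Proof.
move=> homG Gm GK sG; have [n] := ubnP ((fmax X).+1 - #|` X|).
elim: n X => // n IHn X; rewrite ltnS => le_n X0.
have sX := sG X X0; have G0 := normal_hom0 homG X0.
have [//|neqX] := eqVneq (G X) X.
have sub : X `<` G X by rewrite fproperEneq eq_sym neqX; apply/fsubsetP.
have le_GX : #|` G X| <= (fmax X).+1.
  rewrite -(size_iota 0 (fmax X).+1); apply: uniq_leq_size => // x /fmax_ge.
  by rewrite Gm // mem_iota.
have := fproper_ltn_card sub => lt_card.
have GGX : G (G X) = G X by apply: IHn => //; rewrite Gm //; lia.
by rewrite -[RHS]GK // -[in RHS]GGX GK.
Qed.

(** For each [b], one of [G], [rG] and one of [Gr], [rGr] is direct. As [G] excludes [Gr] and [rG]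
    excludes [rGr], even for different values of [b], the alternative at [b = 2] decides all the
    others. *)
Lemma normal_aut_id_or_reflect G H :
  normal_hom G -> normal_hom H -> normal_cancel G H -> normal_cancel H G ->
  (forall X, 0 \in X -> G X = X) \/ (forall X, 0 \in X -> G X = reflect_set X).
Proof.
move=> homG homH GK HK.
have Gm := normal_aut_fmax homG homH GK; have Hm := normal_aut_fmax homH homG HK.
pose rG := fun X => reflect_set (G X); pose Gr := fun X => G (reflect_set X).
pose rGr := fun X => reflect_set (G (reflect_set X)).
have homrG : normal_hom rG := normal_hom_reflectl homG.
have homGr : normal_hom Gr := normal_hom_reflectr homG.
have homrGr : normal_hom rGr := normal_hom_reflectr homrG.
have rGm : fmax_preserving rG := fmax_preserving_reflectl homG Gm.
have Grm : fmax_preserving Gr := fmax_preserving_reflectr Gm.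
have homrH := normal_hom_reflectl homH.
have rHm := fmax_preserving_reflectl homH Hm.
have GrK : normal_cancel Gr (fun X => reflect_set (H X)).
  by move=> X X0; rewrite /= GK ?reflect0 ?reflectK.
have dG b (b1 : 1 < b) : direct b G \/ direct b rG := direct_dichotomy b1 homG homH Gm Hm GK.
have dGr b (b1 : 1 < b) : direct b Gr \/ direct b rGr :=
  direct_dichotomy b1 homGr homrH Grm rHm GrK.
have G_Gr b b' (b1 : 1 < b) (b'1 : 1 < b') : direct b G -> direct b' Gr -> False.
  exact: direct_incompatible.
have rG_rGr b b' (b1 : 1 < b) (b'1 : 1 < b') : direct b rG -> direct b' rGr -> False.
  exact: (@direct_incompatible rG).
case: (dG 2 isT) => d2; [left|right].
  have drGr b : 1 < b -> direct b rGr.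
    by move=> b1; case: (dGr b b1) => // /(G_Gr 2 b isT b1 d2).
  have dG' b : 1 < b -> direct b G.
    by move=> b1; case: (dG b b1) => // d; case: (rG_rGr b 2 b1 isT d (drGr 2 isT)).
  by move=> X; apply: (normal_aut_id homG Gm GK) => Y; apply: direct_subset.
have dGr' b : 1 < b -> direct b Gr.
  by move=> b1; case: (dGr b b1) => // /(rG_rGr 2 b isT b1 d2).
have drG b : 1 < b -> direct b rG.
  by move=> b1; case: (dG b b1) => // d; case: (G_Gr b 2 b1 isT d (dGr' 2 isT)).
move=> X X0; rewrite -[in LHS](reflectK X0).
apply: (normal_aut_id homGr Grm GrK); last exact: reflect0.
move=> Y; apply: direct_subset => // b b1 c le_c.
by rewrite /Gr reflectK ?spur0 //; apply: drG.
Qed.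

(** * Reflection of sets with arbitrary minimum *)

Definition base (X : {fset nat}) : {fset nat} := [fset x - fmin X | x in X].

Lemma base0 X : X != fset0 -> 0 \in base X.
Proof. by move=> X0; apply/imfsetP; exists (fmin X); rewrite ?subnn ?fmin_in. Qed.

Lemma sumset_base X : sumset [fset fmin X] (base X) = X.
Proof.
apply/fsetP => x; rewrite mem_sumset1; apply/andP/idP.
  move=> [le_x /imfsetP[y /= Xy]]; have := fmin_le Xy => le_y eq_xy.
  by have -> : x = y by lia.
by move=> Xx; split; [apply: fmin_le | apply/imfsetP; exists x].
Qed.

(** This is the map of the theorem ([flipE]), in a form to which the properties of [reflect_set]
    transfer by translation. *)
Definition flip X := sumset [fset fmin X] (reflect_set (base X)).

Lemma flipE (X : {fset nat}) : X != fset0 ->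
  flip X = [fset fmax X - x + fmin X | x in X].
Proof.
rewrite /flip => X0; have le_m := fmin_le (fmax_in X0).
have max_b : fmax (base X) = fmax X - fmin X.
  apply: fmaxE => [|y /imfsetP[x /= /fmax_ge le_x ->]]; last exact: leq_sub2r.
  by apply/imfsetP; exists (fmax X); rewrite //= fmax_in.
apply/fsetP => y; rewrite mem_sumset1 in_reflect max_b; apply/and3P/imfsetP.
  move=> [le_y le_yM /imfsetP[x /= Xx eq_x]]; exists x => //.
  by have := fmin_le Xx; have := fmax_ge Xx; lia.
move=> [x /= Xx ->]; have := fmin_le Xx; have := fmax_ge Xx => leM lem.
by split; [lia | lia | apply/imfsetP; exists x => //=; lia].
Qed.

Lemma fmin_sumset1 a X : 0 \in X -> fmin (sumset [fset a] X) = a.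
Proof.
move=> X0; apply: fminE => [|x]; rewrite mem_sumset1; first by rewrite leqnn subnn.
by case/andP.
Qed.

Lemma flip_sumset1 a X : 0 \in X ->
  flip (sumset [fset a] X) = sumset [fset a] (reflect_set X).
Proof.
move=> X0; have min_a := fmin_sumset1 a X0; rewrite /flip min_a; congr (sumset _ (reflect_set _)).
by apply: (@sumset1_inj a); rewrite -{1}min_a sumset_base.
Qed.

Lemma flipK X : X != fset0 -> flip (flip X) = X.
Proof.
move=> X0; have b0 := base0 X0.
by rewrite flip_sumset1 ?reflect0 // reflectK // sumset_base.
Qed.

Lemma sumset1D a b X Y : sumset (sumset [fset a] X) (sumset [fset b] Y)
  = sumset [fset a + b] (sumset X Y).
Proof.
have -> : [fset a + b] = sumset [fset a] [fset b].
  by apply/fsetP => z; rewrite mem_sumset1 !inE; lia.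
by rewrite -!sumsetA; congr sumset; rewrite sumsetA [sumset X _]sumsetC -sumsetA.
Qed.

Lemma flipD X Y : X != fset0 -> Y != fset0 ->
  flip (sumset X Y) = sumset (flip X) (flip Y).
Proof.
move=> X0 Y0; have [bX bY] := (base0 X0, base0 Y0).
rewrite -{1}(sumset_base X) -{1}(sumset_base Y) sumset1D flip_sumset1.
  by rewrite reflectD // -sumset1D.
by apply: mem_sumset bX bY _.
Qed.

(** * Additive maps on a numerical semigroup *)

Section NumSemigroup.
Variable S : numSemigroup.

Lemma numSemigroup_bound : exists K, forall x, K <= x -> x \in S.
Proof.
have [F memF] := numSemigroup_cofinite S; exists (fmax F).+1 => x lt_x.
have [//|] := boolP (x \in S); rewrite -memF => /fmax_ge.
by rewrite leqNgt lt_x.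
Qed.

Lemma numSemigroupMn n x : x \in S -> n.+1 * x \in S.
Proof.
move=> Sx; elim: n => [|n IHn]; first by rewrite mul1n.
by rewrite mulSn numSemigroupD.
Qed.

Variable K : nat.
Hypothesis S_ge : forall x, K <= x -> x \in S.

Section AdditiveMap.
Variable g : nat -> nat.
Hypothesis gD : {in S &, {morph g : x y / x + y}}.

Lemma additive_numSemigroupMn n x : x \in S -> g (n.+1 * x) = n.+1 * g x.
Proof.
move=> Sx; elim: n => [|n IHn]; first by rewrite !mul1n.
by rewrite mulSn gD ?numSemigroupMn // IHn mulSn.
Qed.

(** Computing [g (x * y)] in two ways gives [x * g y = y * g x]. The slope is an integer because [S]
    contains the coprime numbers [K + 1] and [K + 2]. *)
Lemma additive_numSemigroup_linear : exists c, {in S, forall x, g x = c * x}.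
Proof.
have gM x y : x \in S -> y \in S -> 0 < x -> 0 < y -> x * g y = y * g x.
  move=> Sx Sy x0 y0; rewrite -(prednK x0) -(prednK y0).
  by rewrite -!additive_numSemigroupMn ?prednK // mulnC.
pose a := K.+1; have [Sa Sa1] : a \in S /\ a.+1 \in S by split; apply: S_ge; lia.
have : a %| g a.
  have /(Gauss_dvdr _) <- : coprime a a.+1 by exact: coprimenS.
  by rewrite -gM // dvdn_mulr.
case/dvdnP=> c ga; exists c => x Sx.
have [x0|x0] := posnP x.
  by move: Sx; rewrite x0 => S0; have := gD S0 S0; rewrite addn0; lia.
have := gM a x Sa Sx isT x0; rewrite ga mulnA (mulnC x) (mulnC _ a).
by move/eqP; rewrite eqn_pmul2l // => /eqP.
Qed.

End AdditiveMap.

(** Both maps are multiplications by constants, and the product of the constants is 1. *)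
Lemma numSemigroup_aut_id g h :
  {in S, forall x, g x \in S} ->
  {in S &, {morph g : x y / x + y}} -> {in S &, {morph h : x y / x + y}} ->
  {in S, cancel g h} -> {in S, g =1 id}.
Proof.
move=> Sg gD hD gK x Sx.
have [c gE] := additive_numSemigroup_linear gD.
have [c' hE] := additive_numSemigroup_linear hD.
have SK : K.+1 \in S by apply: S_ge.
have := gK _ SK; rewrite hE ?Sg // gE // mulnA => /eqP.
rewrite -{2}[K.+1]mul1n eqn_pmul2r // muln_eq1 => /andP[_ /eqP c1].
by rewrite gE // c1 mul1n.
Qed.

(** Being total, it takes bare sets without proofs; [[fset K]] is a default value for sets that are
    empty or not contained in [S]. *)
Definition to_pfin (X : {fset nat}) : pfin S :=
  insubd (@Pfin S [fset K] (introT andP (conj (mem_neq0 (fset11 K))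
    (introT allP (fun x xK => S_ge (eq_leq (esym (fset1P _ _ xK)))))))) X.

Lemma to_pfinE (X : {fset nat}) :
  X != fset0 -> {subset X <= S} -> to_pfin X = X :> {fset nat}.
Proof.
move=> X0 SX; apply: insubdK; rewrite -topredE /= X0; exact/allP.
Qed.

Lemma to_pfin1 a : a \in S -> to_pfin [fset a] = [fset a] :> {fset nat}.
Proof.
by move=> Sa; apply: to_pfinE => [|x /fset1P->//]; apply: mem_neq0 (fset11 a).
Qed.

Lemma pfin_neq0 (X : pfin S) : X != fset0 :> {fset nat}.
Proof. by case: X => X /= /andP[]. Qed.

Lemma pfin_sub (X : pfin S) : {subset (X : {fset nat}) <= S}.
Proof. by case: X => X /= /andP[_ /allP]. Qed.

Lemma pfinD (X Y : pfin S) : (X + Y)%R = sumset X Y :> {fset nat}.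
Proof. by []. Qed.

Lemma pfin_inj (X Y : pfin S) : X = Y :> {fset nat} -> X = Y.
Proof. exact: val_inj. Qed.

(** * Cancellative elements and fixed singletons *)

Definition cancellative (X : pfin S) :=
  forall Y Z : pfin S, (X + Y = X + Z)%R -> Y = Z.

Lemma cancellative1 a : a \in S -> cancellative (to_pfin [fset a]).
Proof.
move=> Sa Y Z /(congr1 (@fset_of_pfin S)); rewrite !pfinD to_pfin1 //.
by move/sumset1_inj/pfin_inj.
Qed.

(* If [X] has two elements then removing a point from the middle of a long
   interval [Y] does not change [X + Y]. *)
Lemma cancellative_singleton (X : pfin S) :
  cancellative X -> X = [fset fmin X] :> {fset nat}.
Proof.
move=> canX; apply/fsetP => x; apply/idP/fset1P => [Xx|->]; last first.
  exact: fmin_in (pfin_neq0 X).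
apply: contraPeq isT => ne_x; set M := fmax X.
pose Y := sumset [fset K] (segment (2 * M)).
pose Z := sumset [fset K] (cut (2 * M) (fun y => y != M)).
have memY y : (y \in Y) = (K <= y <= K + 2 * M).
  by rewrite mem_sumset1 in_segment; lia.
have memZ y : (y \in Z) = (K <= y <= K + 2 * M) && (y != K + M).
  by rewrite mem_sumset1 in_cut; lia.
have le_X y : y \in (X : {fset nat}) -> y <= M by apply: fmax_ge.
have Xm := fmin_in (pfin_neq0 X); have le_m := fmin_le Xx.
have le_xM := le_X _ Xx.
have pY : to_pfin Y = Y :> {fset nat}.
  apply: to_pfinE => [|y]; first by apply: (@mem_neq0 _ K); rewrite memY; lia.
  by rewrite memY => /andP[/S_ge].
have pZ : to_pfin Z = Z :> {fset nat}.
  apply: to_pfinE => [|y]; first by apply: (@mem_neq0 _ K); rewrite memZ; lia.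
  by rewrite memZ => /andP[/andP[/S_ge]].
have eqYZ : to_pfin Y = to_pfin Z.
  apply: canX; apply: pfin_inj; rewrite !pfinD pY pZ.
  apply/fsetP => z; apply/sumsetP/sumsetP => [[u [y [Xu Yy ->]]]|[u [y [Xu Zy ->]]]].
    have le_u := le_X _ Xu; move: Yy; rewrite memY => le_y.
    (* The removed summand [K + M] is avoided by trading [u] for another element of [X], which moves
       [y] by a nonzero amount of at most [M]. *)
    have [def_y|ne_y] := eqVneq y (K + M); last by exists u, y; rewrite memZ ne_y le_y.
    have [u_x|ne_u] := eqVneq u x.
      by exists (fmin X), (u + y - fmin X); rewrite memZ; split=> //; lia.
    by exists x, (u + y - x); rewrite memZ; split=> //; lia.
  by exists u, y; split=> //; move: Zy; rewrite memZ memY => /andP[].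
have : K + M \in Y by rewrite memY; lia.
by rewrite -pY eqYZ pZ memZ eqxx andbF.
Qed.

Section Automorphism.
Variables f g : pfin S -> pfin S.
Hypotheses (fD : {morph f : X Y / (X + Y)%R}) (gD : {morph g : X Y / (X + Y)%R}).
Hypotheses (fK : cancel f g) (gK : cancel g f).

Lemma cancellative_aut X : cancellative X -> cancellative (f X).
Proof.
move=> canX Y Z eqYZ; apply: (can_inj gK); apply: canX.
by apply: (can_inj fK); rewrite !fD !gK.
Qed.

Lemma aut_singleton a : a \in S ->
  f (to_pfin [fset a]) = [fset fmin (f (to_pfin [fset a]))] :> {fset nat}.
Proof. by move=> Sa; apply/cancellative_singleton/cancellative_aut/cancellative1. Qed.

Lemma fmin_pfin_in (X : pfin S) : fmin X \in S.
Proof. exact/pfin_sub/fmin_in/pfin_neq0. Qed.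

Lemma aut_fmin1D :
  {in S &, {morph (fun a => fmin (f (to_pfin [fset a]))) : x y / x + y}}.
Proof.
move=> x y Sx Sy /=; rewrite -fmin_sumset ?pfin_neq0 // -pfinD -fD.
congr (fmin (f _)); apply: pfin_inj; rewrite pfinD !to_pfin1 ?numSemigroupD //.
by apply/fsetP => z; rewrite mem_sumset1 !inE; lia.
Qed.

End Automorphism.

Lemma aut_fix_singleton (f g : pfin S -> pfin S) a : {morph f : X Y / (X + Y)%R} ->
  {morph g : X Y / (X + Y)%R} -> cancel f g -> cancel g f ->
  a \in S -> f (to_pfin [fset a]) = to_pfin [fset a].
Proof.
move=> fD gD fK gK Sa; apply: pfin_inj.
rewrite (aut_singleton fD fK gK) // to_pfin1 //; congr [fset _].
apply: (numSemigroup_aut_id _ (aut_fmin1D fD) (aut_fmin1D gD)) a Sa => [a _|a Sa].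
  exact: fmin_pfin_in.
have -> : to_pfin [fset fmin (f (to_pfin [fset a]))] = f (to_pfin [fset a]).
  by apply: pfin_inj; rewrite to_pfin1 ?fmin_pfin_in // -(aut_singleton fD fK gK).
by rewrite fK to_pfin1 // fmin1.
Qed.

(** * Automorphisms preserve minima *)

(* [multiple X n] is the (n+1)-fold sum of [X]. *)
Definition multiple (X : pfin S) n := iter n (fun Y => X + Y)%R X.

Lemma multiple_additive (phi : pfin S -> nat) X n :
  (forall Y Z, phi (Y + Z)%R = phi Y + phi Z) -> phi (multiple X n) = n.+1 * phi X.
Proof.
move=> phiD; elim: n => [|n IHn]; first by rewrite mul1n.
by rewrite mulSn -IHn -phiD.
Qed.

Lemma fminD (X Y : pfin S) : fmin (X + Y)%R = fmin X + fmin Y.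
Proof. by rewrite pfinD fmin_sumset ?pfin_neq0. Qed.

Lemma fmaxD (X Y : pfin S) : fmax (X + Y)%R = fmax X + fmax Y.
Proof. by rewrite pfinD fmax_sumset ?pfin_neq0. Qed.

(** For [J = K + [0, fmax X]], the sums [X + J] and [Y + J] are the same interval, and [phi J]
    cancels. *)
Lemma additive_fmin_fmax (phi : pfin S -> nat) (X Y : pfin S) :
  (forall Z T, phi (Z + T)%R = phi Z + phi T) ->
  fmin X = fmin Y -> fmax X = fmax Y -> phi X = phi Y.
Proof.
move=> phiD eq_min eq_max; pose J := sumset [fset K] (segment (fmax X)).
have memJ y : (y \in J) = (K <= y <= K + fmax X).
  by rewrite mem_sumset1 in_segment; lia.
have pJ : to_pfin J = J :> {fset nat}.
  apply: to_pfinE => [|y]; first by apply: (@mem_neq0 _ K); rewrite memJ; lia.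
  by rewrite memJ => /andP[/S_ge].
have addJ (Z : pfin S) z : fmax Z = fmax X ->
    (z \in sumset Z J) = (fmin Z + K <= z <= fmax Z + (K + fmax X)).
  move=> eqZ; have [Zm ZM] := (fmin_in (pfin_neq0 Z), fmax_in (pfin_neq0 Z)).
  apply/sumsetP/idP => [[u [v [Zu + ->]]]|le_z].
    by rewrite memJ; have := fmin_le Zu; have := fmax_ge Zu; lia.
  have := fmin_le ZM; have [le_zm|lt_zm] := leqP z (fmin Z + (K + fmax X)) => le_mM.
    by exists (fmin Z), (z - fmin Z); rewrite memJ; split=> //; lia.
  by exists (fmax Z), (z - fmax Z); rewrite memJ; split=> //; lia.
apply/eqP; rewrite -(eqn_add2r (phi (to_pfin J))) -!phiD; apply/eqP; congr phi.
apply: pfin_inj; rewrite !pfinD pJ; apply/fsetP => z.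
by rewrite !addJ // eq_min eq_max.
Qed.

(** Let [u] be the least element of [S]. The set [X' = {u, v}] is built so that [X'] plus [K + 1]
    copies of [{x0}] has the extrema of [K + 1] copies of [X] plus [{u}]. Thus
    [phi X' + (K + 1) x0 = (K + 1) phi X + u], and [u <= phi X'] yields the bound. *)
Lemma le_fmin_aut (f : pfin S -> pfin S) (X : pfin S) : {morph f : X Y / (X + Y)%R} ->
  (forall a, a \in S -> f (to_pfin [fset a]) = to_pfin [fset a]) ->
  fmin X <= fmin (f X).
Proof.
move=> fD f1; pose phi Y := fmin (f Y).
have phiD Y Z : phi (Y + Z)%R = phi Y + phi Z by rewrite /phi fD fminD.
have [u Su le_u] : exists2 u, u \in S & forall x, x \in S -> u <= x.
  have exS : exists x, x \in S by exists K; apply: S_ge.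
  by case: (ex_minnP exS) => u Su le_u; exists u.
have phi1 a : a \in S -> phi (to_pfin [fset a]) = a.
  by move=> Sa; rewrite /phi f1 // to_pfin1 // fmin1.
have min1 a : a \in S -> fmin (to_pfin [fset a]) = a by move=> Sa; rewrite to_pfin1 ?fmin1.
have max1 a : a \in S -> fmax (to_pfin [fset a]) = a by move=> Sa; rewrite to_pfin1 ?fmax1.
have Sx0 := fmin_pfin_in X; set x0 := fmin X in Sx0 *.
have le_x0 : x0 <= fmax X by apply/fmin_le/fmax_in/pfin_neq0.
(* The factor [K + 1] puts [v] in [S]: either [v = u] or [v > K]. *)
pose v := u + K.+1 * (fmax X - x0).
have Sv : v \in S.
  rewrite /v; have [->|d0] := posnP (fmax X - x0); first by rewrite muln0 addn0.
  by apply: S_ge; rewrite (leq_trans (leqnSn K)) // (leq_trans (leq_pmulr _ d0)) ?leq_addl.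
have le_uv : u <= v by rewrite leq_addr.
have pX' : to_pfin [fset u; v] = [fset u; v] :> {fset nat}.
  apply: to_pfinE => [|y]; first by apply: mem_neq0 (fset21 u v).
  by case/fset2P=> ->.
set X' := to_pfin [fset u; v] in pX'.
have minX' : fmin X' = u.
  by rewrite pX'; apply: fminE => [|y /fset2P[]->]; rewrite ?fset21.
have maxX' : fmax X' = v.
  by rewrite pX'; apply: fmaxE => [|y /fset2P[]->]; rewrite ?fset22.
(* Both arguments have the same minimum and the same maximum. *)
have : phi (X' + multiple (to_pfin [fset x0]) K)%R
     = phi (multiple X K + to_pfin [fset u])%R.
  apply: additive_fmin_fmax => //.
    by rewrite !fminD !(multiple_additive _ _ fminD) ?min1 ?minX' // addnC.
  rewrite !fmaxD !(multiple_additive _ _ fmaxD) ?max1 ?maxX' //.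
  by rewrite /v -addnA -mulnDr subnK // addnC.
rewrite !phiD !(multiple_additive _ _ phiD) !phi1 // => eq_phi.
have le_phi : u <= phi X' by apply/le_u/fmin_pfin_in.
rewrite -/(phi X) -(leq_pmul2l (ltn0Sn K)) -(leq_add2r u) -eq_phi addnC.
by rewrite leq_add2r.
Qed.

Lemma fmin_aut (f g : pfin S -> pfin S) (X : pfin S) : {morph f : X Y / (X + Y)%R} ->
  {morph g : X Y / (X + Y)%R} -> cancel f g -> cancel g f -> fmin (f X) = fmin X.
Proof.
move=> fD gD fK gK; apply/eqP; rewrite eqn_leq; apply/andP; split.
  rewrite -{2}(fK X); apply: le_fmin_aut => // a.
  exact: aut_fix_singleton gD fD gK fK.
by apply: le_fmin_aut => // a; apply: aut_fix_singleton fD gD fK gK.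
Qed.

(** * From automorphisms to normalised homomorphisms *)

Definition shift (X : {fset nat}) := sumset [fset K] X.

Lemma to_pfin_shift X : 0 \in X -> to_pfin (shift X) = shift X :> {fset nat}.
Proof.
move=> X0; apply: to_pfinE => [|x].
  by apply: (@mem_neq0 _ K); rewrite mem_sumset1 leqnn subnn.
by rewrite mem_sumset1 => /andP[/S_ge].
Qed.

(** As 0 need not be in [S], sets are moved up by [K] before [f] applies. For an automorphism [f]
    and a set [X] containing 0, the truncated subtraction loses nothing, because [f] preserves the
    minimum [K]. *)
Definition normalise (f : pfin S -> pfin S) (X : {fset nat}) : {fset nat} :=
  [fset x - K | x in (f (to_pfin (shift X)) : {fset nat})].

Section Normalise.
Variables f g : pfin S -> pfin S.
Hypotheses (fD : {morph f : X Y / (X + Y)%R}) (gD : {morph g : X Y / (X + Y)%R}).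
Hypotheses (fK : cancel f g) (gK : cancel g f).

Lemma normaliseE X : 0 \in X -> shift (normalise f X) = f (to_pfin (shift X)).
Proof.
move=> X0; have min_f := fmin_aut (to_pfin (shift X)) fD gD fK gK.
rewrite to_pfin_shift // fmin_sumset1 // in min_f.
apply/fsetP => x; rewrite mem_sumset1; apply/andP/idP.
  move=> [le_x /imfsetP[y /= fy eq_xy]]; have := fmin_le fy.
  by rewrite min_f => le_y; have -> : x = y by lia.
move=> fx; have := fmin_le fx; rewrite min_f => le_x; split=> //.
by apply/imfsetP; exists x.
Qed.

Lemma normal_hom_normalise : normal_hom (normalise f).
Proof.
split=> [X X0|X Y X0 Y0].
  have := fmin_in (pfin_neq0 (f (to_pfin (shift X)))).
  rewrite (fmin_aut _ fD gD fK gK) to_pfin_shift // fmin_sumset1 // -normaliseE //.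
  by rewrite mem_sumset1 subnn leqnn.
have SK : K \in S by apply: S_ge.
have XY0 : 0 \in sumset X Y by apply: mem_sumset X0 Y0 _.
(* [shift X] and [shift Y] bring two translations by [K], but [shift (sumset X Y)] only one; the
   fixed singleton [[fset K]] supplies the other. *)
apply: (@sumset1_inj K); apply: (@sumset1_inj K).
transitivity (f (to_pfin [fset K] + to_pfin (shift (sumset X Y)))%R : {fset nat}).
  by rewrite fD pfinD (aut_fix_singleton fD gD fK gK) // to_pfin1 // -normaliseE.
transitivity (f (to_pfin (shift X) + to_pfin (shift Y))%R : {fset nat}).
  congr (fset_of_pfin (f _)); apply: pfin_inj.
  rewrite !pfinD to_pfin1 // !to_pfin_shift // /shift.
  by rewrite -!sumsetA; congr sumset; rewrite sumsetA [sumset [fset K] X]sumsetC -sumsetA.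
rewrite fD pfinD -!normaliseE // /shift -!sumsetA; congr sumset.
by rewrite sumsetA [sumset _ [fset K]]sumsetC -sumsetA.
Qed.

Lemma normalise_cancel : normal_cancel (normalise f) (normalise g).
Proof.
move=> X X0; have f0 := normal_hom0 normal_hom_normalise X0.
apply/fsetP => x.
have -> : normalise g (normalise f X) = [fset x - K | x in shift X].
  rewrite /normalise; have -> : to_pfin (shift (normalise f X)) = f (to_pfin (shift X)).
    by apply: pfin_inj; rewrite to_pfin_shift // normaliseE.
  by rewrite fK to_pfin_shift.
apply/imfsetP/idP => [[y /=]|Xx]; first by rewrite mem_sumset1 => /andP[_ +] ->.
by exists (K + x); rewrite /= ?mem_sumset1 ?leq_addr addKn.
Qed.

(** Apply [f], which fixes singletons, to both sides of [K + X = fmin X + shift (base X)]. *)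
Lemma aut_normalise (X : pfin S) : f X = sumset [fset fmin X] (normalise f (base X)) :> {fset nat}.
Proof.
have [SK Sx] : K \in S /\ fmin X \in S by rewrite S_ge ?fmin_pfin_in.
have b0 := base0 (pfin_neq0 X).
apply: (@sumset1_inj K).
transitivity (f (to_pfin [fset K] + X)%R : {fset nat}).
  by rewrite fD pfinD (aut_fix_singleton fD gD fK gK) // to_pfin1.
transitivity (f (to_pfin [fset fmin X] + to_pfin (shift (base X)))%R : {fset nat}).
  congr (fset_of_pfin (f _)); apply: pfin_inj.
  rewrite !pfinD !to_pfin1 // to_pfin_shift // /shift sumsetA.
  by rewrite [sumset [fset fmin X] _]sumsetC -sumsetA sumset_base.
rewrite fD pfinD (aut_fix_singleton fD gD fK gK) // to_pfin1 // -normaliseE //.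
by rewrite /shift !sumsetA; congr sumset; rewrite sumsetC.
Qed.

End Normalise.

(** * Classification of the automorphisms *)

Lemma aut_id_or_reflect (f : pfin S -> pfin S) : automorphism f ->
  f =1 id \/ forall X : pfin S,
    f X = [fset fmax X - x + fmin X | x in (X : {fset nat})] :> {fset nat}.
Proof.
move=> [[g fK gK] fD].
have gD : {morph g : X Y / (X + Y)%R}.
  by move=> X Y; apply: (can_inj fK); rewrite fD !gK.
have homF := normal_hom_normalise fD gD fK gK.
have homG := normal_hom_normalise gD fD gK fK.
have FK := normalise_cancel fD gD fK gK; have GK := normalise_cancel gD fD gK fK.
case: (normal_aut_id_or_reflect homF homG FK GK) => FE; [left|right] => X.
  apply: pfin_inj; rewrite (aut_normalise fD gD fK gK) FE ?sumset_base //.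
  exact: base0 (pfin_neq0 X).
have b0 := base0 (pfin_neq0 X).
by rewrite (aut_normalise fD gD fK gK) FE // -flipE // pfin_neq0.
Qed.

(** Reflecting the subset [{a, K + a, K + l}] of [S] sends [K + a] to [l]. *)
Lemma reflect_aut_upward (f : pfin S -> pfin S) a l :
  (forall X : pfin S,
    f X = [fset fmax X - x + fmin X | x in (X : {fset nat})] :> {fset nat}) ->
  a \in S -> a <= l -> l \in S.
Proof.
move=> fE Sa le_al; pose w := K + l.
pose X := [fset a; K + a; w].
have SX : {subset X <= S}.
  move=> x; rewrite !inE -orbA => /or3P[]/eqP-> //; apply: S_ge; rewrite ?leq_addr //.
have Xa : a \in X by rewrite !inE eqxx.
have pX : to_pfin X = X :> {fset nat} by apply: to_pfinE SX; apply: mem_neq0 Xa.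
have maxX : fmax X = w.
  by apply: fmaxE => [|x]; rewrite !inE -?orbA ?eqxx ?orbT // => /or3P[]/eqP->; lia.
have minX : fmin X = a.
  by apply: fminE => [|x]; rewrite !inE -?orbA ?eqxx ?orbT // => /or3P[]/eqP->; lia.
apply: (@pfin_sub (f (to_pfin X))); rewrite fE pX maxX minX.
apply/imfsetP; exists (K + a); first by rewrite /= !inE eqxx ?orbT.
by rewrite /w; lia.
Qed.

End NumSemigroup.

Theorem theorem1p3 (S : numSemigroup) :
  ((exists k : nat, S =i [pred l : nat | k <= l]) ->
     exists sigma : pfin S -> pfin S,
       [/\ forall X : pfin S,
             sigma X = [fset fmax X - x + fmin X | x in (X : {fset nat})]
               :> {fset nat},
           automorphism sigma,
           involutive sigma,
           ~ (sigma =1 id)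
         & forall f : pfin S -> pfin S,
             automorphism f -> ~ (f =1 id) -> f =1 sigma])
  /\
  (~ (exists k : nat, S =i [pred l : nat | k <= l]) ->
     forall f : pfin S -> pfin S, automorphism f <-> f =1 id).
Proof.
split=> [[k Sk]|notS f]; last first.
  have [K S_ge] := numSemigroup_bound S.
  split=> [autf|f1]; last first.
    by split=> [|X Y]; [exists id => X; rewrite !f1 | rewrite !f1].
  case: (aut_id_or_reflect S_ge autf) => // fE; case: notS.
  have exS : exists x, x \in S by exists K; apply: S_ge.
  case: (ex_minnP exS) => u Su le_u; exists u => l; rewrite inE.
  by apply/idP/idP => [/le_u //|]; apply: (reflect_aut_upward S_ge fE).
have S_ge x : k <= x -> x \in S by rewrite Sk.
pose sigma (X : pfin S) : pfin S := to_pfin S_ge (flip X).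
have sigma_flip X : sigma X = flip X :> {fset nat}.
  apply: to_pfinE => [|x]; rewrite flipE ?pfin_neq0 //.
    apply/(@mem_neq0 _ (fmin X))/imfsetP; exists (fmax X); last by rewrite subnn.
    exact: fmax_in (pfin_neq0 X).
  by case/imfsetP=> y _ ->; have := fmin_pfin_in X; rewrite !Sk !inE; lia.
have sigmaE X : sigma X = [fset fmax X - x + fmin X | x in (X : {fset nat})] :> {fset nat}.
  by rewrite sigma_flip flipE ?pfin_neq0.
have sigmaK : involutive sigma.
  by move=> X; apply: pfin_inj; rewrite !sigma_flip flipK ?pfin_neq0.
have sigmaD : {morph sigma : X Y / (X + Y)%R}.
  by move=> X Y; apply: pfin_inj; rewrite pfinD !sigma_flip pfinD flipD ?pfin_neq0.
exists sigma; split=> //.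
- by split=> //; exists sigma.
(* An asymmetric set: its reflection is [{k, k+2, k+3}]. *)
- pose X := [fset k; k.+1; k.+3].
  have memX x : (x \in X) = [|| x == k, x == k.+1 | x == k.+3] by rewrite !inE orbA.
  have pX : to_pfin S_ge X = X :> {fset nat}.
    apply: to_pfinE => [|x]; first by apply: (@mem_neq0 _ k); rewrite memX eqxx.
    by rewrite memX Sk inE; lia.
  have minX : fmin X = k.
    by apply: fminE => [|x]; rewrite memX ?eqxx // => x_k; lia.
  have maxX : fmax X = k.+3.
    by apply: fmaxE => [|x]; rewrite memX ?eqxx ?orbT // => x_k; lia.
  move=> /(_ (to_pfin S_ge X))/(congr1 (fun Y : pfin S => k.+2 \in (Y : {fset nat}))).
  rewrite sigmaE pX maxX minX memX => /esym; rewrite !eqn_leq.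
  have -> : k.+2 \in [fset k.+3 - x + k | x in X]; last by lia.
  by apply/imfsetP; exists k.+1; rewrite /= ?memX ?eqxx ?orbT //; lia.
move=> f autf f1 X; case: (aut_id_or_reflect S_ge autf) => // fE.
by apply: pfin_inj; rewrite fE sigmaE.
Qed.
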